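(* For every integer $d \ge 3$, every real number $0 < \varepsilon < 1$, and every integer $k$, there exist a finite family $F$ of convex sets in $\mathbb{R}^d$ and a finite set $L$ of lines in general position in $\mathbb{R}^d$ such that: (1) every member $K \in F$ intersects at least $\varepsilon |L|$ of the lines in $L$; and (2) for any set of $k$ lines in $\mathbb{R}^d$, at least one member $K \in F$ is disjoint from all $k$ of these lines. *)

(* Defs.v *)
From HB Require Import structures.
From mathcomp Require Import all_boot all_order all_algebra finmap.
From mathcomp Require Import all_classical all_reals convex.

Set Implicit Arguments.
Unset Strict Implicit.
Unset Printing Implicit Defensive.
Import Order.TTheory GRing.Theory Num.Theory.

Local Open Scope classical_set_scope.
Local Open Scope ring_scope.

Section Lines.
Variables (R : realType) (d : nat).
Implicit Types (p v : 'rV[R]_d) (U : {vspace 'rV[R]_d}) (l : set 'rV[R]_d).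

Definition is_line l : Prop :=
  exists p v, v != 0 /\ l = [set p + t *: v | t in [set: R]].

Definition flat p U : set 'rV[R]_d := [set x | x - p \in U].

Definition parallel_to l U : Prop := exists q, l `<=` flat q U.

(* No flat contains a >= 1 of the lines while being parallel to b further ones,
   unless its dimension is at least the value min(d, 2a - 1 + b) that is forced
   for generic lines: a generic lines span a flat of dimension min(d, 2a - 1),
   and each further direction raises this dimension by one until it reaches d.
   For d >= 3, the case (a, b) = (2, 0) says that any two lines are skew (neither
   meeting nor parallel), and a = 1 says that any m <= d of the lines have
   linearly independent directions; e.g. no three are parallel to a plane. *)
Definition general_position (L : {fset set 'rV[R]_d}) : Prop :=
  forall (A B : {fset set 'rV[R]_d}) p U,
    (A `<=` L)%fset -> (B `<=` L)%fset -> [disjoint A & B]%fset -> A != fset0 ->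
    (forall l, l \in A -> l `<=` flat p U) ->
    (forall l, l \in B -> parallel_to l U) ->
    (minn d (2 * #|` A| + #|` B|).-1 <= \dim U)%N.

End Lines.

(* Main.v *)
Require Import Defs.
From HB Require Import structures.
From mathcomp Require Import all_boot all_order all_algebra finmap.
From mathcomp Require Import all_classical all_reals convex.
From mathcomp Require Import interval_inference.
From mathcomp Require Import ring lra zify.

Set Implicit Arguments.
Unset Strict Implicit.
Unset Printing Implicit Defensive.
Import Order.TTheory GRing.Theory Num.Theory.

Local Open Scope classical_set_scope.
Local Open Scope ring_scope.

(* Let [L] consist of [n] lines [l_s = {(s, s t, t)}] of one ruling of the quadric [y = x z],
   crossed with a point of [R^(d-3)].  The plane [z = t + e x] meets them in the points of the
   parabola [y - t x = e x^2], so a set [K] in that plane (a cylinder over it if [d > 3]) bounded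
   by chords of the parabola meets all of them but the few whose arcs are cut off, and it lies
   within [O(e)] of a segment of the line of the other ruling at height [t].  A line on which [y - x z] is much larger than
   [e] comes near this segment for at most two of the (well separated) heights [t]; a line on
   which it is much smaller than [e] runs along some [l_s], and misses every [K] with the arc
   around [s] cut off.  For [k] lines there is, among [k + 1] widely separated scales [e], one
   at which each line is of one of these two kinds, and then, among [2 k + 1] heights, one that
   avoids all lines of the first kind.  The lines of [L] meet the sets [K], slightly thickened,
   in their interior, so [L] can be moved into general position. *)

(** * Generic perturbation of points and directions *)

Lemma proper_vspace_annihilator (F : fieldType) (n : nat) (W : {vspace 'rV[F]_n}) :
  (\dim W < n)%N -> exists2 h : 'cV[F]_n, h != 0 & forall w, w \in W -> w *m h = 0.
Proof.
move=> ltWn.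
(* This matrix kills [W] and is nonzero when [W] is proper, so any nonzero column of it serves as
   [h]. *)
pose f := lin1_mx (\1 - projv W)%VF.
have fE w : w *m f = w - projv W w.
  by rewrite mul_rV_lin1 /= add_lfunE opp_lfunE id_lfunE.
have f_neq0 : f != 0.
  apply: contraTneq ltWn => f0; rewrite -leqNgt.
  suff -> : W = fullv by rewrite dimvf dim_matrix mul1r.
  apply/vspaceP => w; rewrite memvf.
  have := fE w; rewrite f0 mulmx0 => /esym/subr0_eq ->.
  exact: memv_proj.
have [j fj0] : exists j, col j f != 0.
  apply/existsP; apply: contraNT f_neq0; rewrite negb_exists => /forallP f0.
  apply/eqP/matrixP => i j; have := f0 j; rewrite negbK => /eqP/matrixP/(_ i 0).
  by rewrite !mxE.
exists (col j f) => // w wW.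
by rewrite colE mulmxA fE projv_id // subrr mul0mx.
Qed.

Lemma exists_nonroot_lt (F : realFieldType) (p : {poly F}) (e : F) :
  p != 0 -> 0 < e -> exists2 x, 0 < x < e & ~~ root p x.
Proof.
move=> p0 e0; pose r := [seq e / n.+2%:R | n <- iota 0 (size p)].
have /allPn[x xr px] : ~~ all (root p) r.
  apply: contraTN (leqnn (size p)) => ar; rewrite -ltnNge.
  have {1}<- : size r = size p by rewrite size_map size_iota.
  apply: max_poly_roots => //.
  rewrite map_inj_uniq ?iota_uniq // => m n /(mulfI (lt0r_neq0 e0))/invr_inj/eqP.
  by rewrite eqr_nat => /eqP[].
exists x => //; case/mapP: xr => n _ ->.
by rewrite divr_gt0 // ltr_pdivrMr // ltr_pMr // ltr1n.
Qed.

(** Moving [x0] along the moment curve [(t, t^2, ..., t^d)] turns each condition into the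
    nonvanishing at [t] of a nonzero polynomial, and some small [t] avoids the roots of their
    product. If [c = 0], the first entry of [h] has no effect, so the others must not all vanish. *)
Lemma exists_off_hyperplanes (F : realFieldType) (d : nat) (c e : F) (x0 : 'rV[F]_d)
    (hs : seq 'cV[F]_(1 + d)) :
  0 < e ->
  (forall h, h \in hs -> h != 0 /\ (c = 0 -> dsubmx h != 0)) ->
  exists x : 'rV[F]_d, (forall j, `|x 0 j - x0 0 j| < e) /\
    (forall h, h \in hs -> row_mx c%:M x *m h != 0).
Proof.
move=> e0 hsP.
pose P (h : 'cV[F]_(1 + d)) : {poly F} :=
  (usubmx h 0 0 * c + \sum_j x0 0 j * dsubmx h j 0)%:P
  + \sum_j dsubmx h j 0 *: 'X^(j.+1).
have P0 h : h \in hs -> P h != 0.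
  move=> /hsP[h0 ch]; apply/eqP => Ph.
  have g0 : dsubmx h = 0.
    apply/matrixP => j k; rewrite ord1 [RHS]mxE.
    have := congr1 (fun p : {poly F} => p`_j.+1) Ph.
    rewrite coefD coefC coef0 /= add0r coef_sum (bigD1 j) //= coefZ coefXn eqxx mulr1.
    rewrite big1 ?addr0 => [<- //|i ij].
    by rewrite coefZ coefXn eqSS eq_sym val_eqE (negbTE ij) /= mulr0n mulr0.
  have c0 : c != 0 by apply/eqP => /ch; rewrite g0 eqxx.
  have := congr1 (fun p : {poly F} => p`_0) Ph.
  have -> : (P h)`_0 = usubmx h 0 0 * c.
    rewrite coefD coefC /= coef_sum !big1 ?addr0 // => j _; last by rewrite g0 mxE mulr0.
    by rewrite coefZ coefXn mulr0.
  rewrite coef0 => /eqP; rewrite mulf_eq0 (negbTE c0) orbF => /eqP u0.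
  move/eqP: h0; apply; rewrite -[h]vsubmxK g0.
  rewrite [usubmx h](_ : _ = 0) ?col_mx0 //.
  by apply/matrixP => i j; rewrite !ord1 u0 mxE.
(* The bound [t < 1] makes every [t ^+ j.+1] at most [t], hence less than [e]. *)
have [||t /andP[t0 te] nr] := @exists_nonroot_lt F (\prod_(h <- hs) P h) (Num.min e 1).
- by rewrite prodf_seq_neq0; apply/allP => h hh; rewrite P0.
- by rewrite lt_min e0 ltr01.
move: te; rewrite lt_min => /andP[te t1].
exists (\row_j (x0 0 j + t ^+ j.+1)); split=> [j|h hh].
  rewrite mxE addrAC subrr add0r ger0_norm ?exprn_ge0 ?ltW //.
  by rewrite (le_lt_trans _ te) // exprS ger_pMr // exprn_ile1 ?ltW.
apply: contraNN nr => /eqP/matrixP/(_ 0 0).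
rewrite -{1}[h]vsubmxK mul_row_col mul_scalar_mx.
have -> : (c *: usubmx h + (\row_j (x0 0 j + t ^+ j.+1)) *m dsubmx h) 0 0 = (P h).[t].
  rewrite hornerD hornerC horner_sum -addrA [usubmx h 0 0 * c]mulrC [LHS]mxE [X in X + _]mxE.
  congr (_ + _); rewrite [LHS]mxE -big_split; apply: eq_bigr => j _.
  by rewrite hornerZ hornerXn [in LHS]mxE mulrDl [dsubmx _ _ _ * _]mulrC.
rewrite [RHS]mxE => h0; apply/rootP; rewrite horner_prod (big_rem h) //=.
by rewrite h0 mul0r.
Qed.

(** Homogeneous coordinates: [b] tells a point of the affine space from a direction, that is, a
    point at infinity. *)
Definition homogenize (F : fieldType) (d : nat) (b : bool) (x : 'rV[F]_d) : 'rV[F]_(1 + d) :=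
  row_mx b%:R%:M x.

(** By induction, the head is moved off a hyperplane through the span of each relevant sublist of
    the tail. Directions precede points in [s], hence are placed after them. Directions alone cannot
    leave the hyperplane at infinity, so only selections with a point are considered. *)
Lemma generic_perturbation (F : realFieldType) (d : nat) (I : eqType) (pt : pred I)
    (x0 : I -> 'rV[F]_d) (e : F) (s : seq I) :
  0 < e -> uniq s -> pairwise (fun i j => pt i ==> pt j) s ->
  exists x : I -> 'rV[F]_d, (forall i j, `|x i 0 j - x0 i 0 j| < e) /\
    forall P : pred I, has pt (seq.filter P s) ->
    (minn d.+1 (count P s) <= \dim <<[seq homogenize (pt i) (x i) | i <- s & P i]>>)%N.
Proof.
move=> e0; elim: s => [_ _|i s IHs /= /andP[nis us] /andP[pti pts]].
  by exists x0; split=> // i j; rewrite subrr normr0.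
have [x [xe xP]] := IHs us pts.
pose span_of (m : (size s).-tuple bool) :=
  <<[seq homogenize (pt i) (x i) | i <- mask m s]>>%VS.
pose relevant m := (\dim (span_of m) < d.+1)%N && (pt i || has pt (mask m s)).
have /choice[h hP] m : exists h : 'cV[F]_(1 + d), relevant m ->
    [/\ h != 0, (pt i)%:R = 0 :> F -> dsubmx h != 0 &
        forall w, w \in span_of m -> w *m h = 0].
  have [/andP[lt_d has_pt]|_] := boolP (relevant m); last by exists 0.
  have [h h0 hW] := proper_vspace_annihilator lt_d.
  (* The hyperplane at infinity contains no point, so it cannot contain the span when the sublist
     has one. *)
  exists h => _; split => // /eqP; rewrite pnatr_eq0 eqb0 => nti.
  move: has_pt; rewrite (negbTE nti) => /hasP[j js ptj].
  apply: contraNneq h0 => h0.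
  have := hW _ (memv_span (map_f (fun i => homogenize (pt i) (x i)) js)).
  rewrite -[h]vsubmxK h0 ptj mul_row_col mulmx0 addr0 mul_scalar_mx scale1r => ->.
  by rewrite col_mx0.
have [|y [ye yP]] := @exists_off_hyperplanes F d (pt i)%:R e (x0 i) 
  [seq h m | m <- enum [pred m | relevant m]] e0.
  by move=> _ /mapP[m +] ->; rewrite mem_enum inE => /hP[].
exists (fun j => if j == i then y else x j); split=> [j k|P hasP].
  by case: eqP => [->|_].
have eq_x (t : seq I) : i \notin t ->
    [seq homogenize (pt j) (if j == i then y else x j) | j <- t] =
    [seq homogenize (pt j) (x j) | j <- t].
  by move=> it; apply/eq_in_map => j jt; case: eqP jt it => // -> ->.
have inP : i \notin seq.filter P s by rewrite mem_filter negb_and nis orbT.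
case: ifP hasP => Pi /= hasP; last by rewrite eq_x // add0n xP.
rewrite eqxx eq_x // span_cons add1n.
set V := <<_>>%VS; set w := homogenize _ _.
pose m : (size s).-tuple bool := [tuple of map P (in_tuple s)].
have mE : mask m s = seq.filter P s by rewrite seq.filter_mask.
have VE : V = span_of m by rewrite /V /span_of mE.
have [dV|dV] := leqP d.+1 (\dim V).
  by rewrite (leq_trans (geq_minl _ _)) // (leq_trans dV) // dimvS ?addvSr.
have wV : w \notin V.
  have rm : relevant m by rewrite /relevant -VE dV mE.
  have hm : h m \in [seq h m | m <- enum [pred m | relevant m]].
    by apply: map_f; rewrite mem_enum.
  have [_ _ hV] := hP m rm.
  by apply: contraNN (yP _ hm) => /[!VE] /hV ->.
have w0 : w != 0 by apply: contraNneq wV => ->; rewrite mem0v.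
rewrite dimv_disjoint_sum; last first.
  apply/eqP; rewrite -subv0; apply/subvP => v; rewrite memv_cap => /andP[/vlineP[a ->]].
  have [->|a0] := eqVneq a 0; first by rewrite scale0r !mem0v.
  by rewrite rpredZeq (negbTE a0) (negbTE wV).
rewrite dim_vline w0 /=.
(* If the tail selection has no point, it is empty: otherwise [i] would be the point required by
   [hasP], and the order of [s] would make all later entries points. *)
have {}xP : (minn d.+1 (count P s) <= \dim V)%N.
  have [/xP //|/hasPn hs] := boolP (has pt (seq.filter P s)).
  move: hasP; case E: (seq.filter P s) hs => [|j t] hs; first by rewrite -size_filter E minn0.
  have : j \in seq.filter P s by rewrite E mem_head.
  have ntj := hs j (mem_head _ _); rewrite mem_filter => /andP[_ /(allP pti)].
  rewrite (negbTE ntj) implybF => /negbTE -> /= /orP[]; first by rewrite (negbTE ntj).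
  by case/hasP => j' j't; rewrite (negbTE (hs j' _)) // inE j't orbT.
rewrite minnSS; suff : (minn d (count P s) <= \dim V)%N by [].
by apply: leq_trans xP; rewrite leq_min geq_minr leqW // geq_minl.
Qed.

(** Stated for indices instead of lines, so that distinctness of the lines becomes a consequence. *)
Definition generic_lines (F : fieldType) (d n : nat) (u v : 'I_n -> 'rV[F]_d) : Prop :=
  forall (A B : {set 'I_n}) (p : 'rV[F]_d) (U : {vspace 'rV[F]_d}),
    [disjoint A & B]%B -> A != finset.set0 ->
    (forall i, i \in A -> u i - p \in U) -> (forall i, i \in A :|: B -> v i \in U) ->
    (minn d (2 * #|A| + #|B|).-1 <= \dim U)%N.

(** The [2 n] homogenized vectors are perturbed together. The points and directions of [A] and the
    directions of [B] are [2 #|A| + #|B|] of them, and they lie in the span of [(1, p)] and [0 x U],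
    of dimension at most [1 + \dim U]. *)
Lemma exists_generic_lines (F : realFieldType) (d n : nat) (u0 v0 : 'I_n -> 'rV[F]_d) (e : F) :
  0 < e -> exists u v : 'I_n -> 'rV[F]_d,
    [/\ forall i j, `|u i 0 j - u0 i 0 j| < e, forall i j, `|v i 0 j - v0 i 0 j| < e
      & generic_lines u v].
Proof.
move=> e0.
pose s : seq (bool * 'I_n) :=
  [seq (false, i) | i <- enum 'I_n] ++ [seq (true, i) | i <- enum 'I_n].
have [|| x [xe xP]] := @generic_perturbation F d (bool * 'I_n)%type fst
    (fun bi => if bi.1 then u0 bi.2 else v0 bi.2) e s e0.
- rewrite cat_uniq; apply/and3P; split.
  + by rewrite map_inj_uniq ?enum_uniq // => i j [].
  + by apply/hasPn => _ /mapP[i _ ->]; apply/mapP => -[].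
  + by rewrite map_inj_uniq ?enum_uniq // => i j [].
- rewrite pairwise_cat; apply/and3P; split.
  + by apply/allrelP => _ _ /mapP[i _ ->] /mapP[j _ ->].
  + by rewrite pairwise_map; elim: (enum _) => //= i t ->; rewrite andbT; apply/allP.
  + by rewrite pairwise_map; elim: (enum _) => //= i t ->; rewrite andbT; apply/allP.
exists (fun i => x (true, i)), (fun i => x (false, i)).
split=> [i j|i j|A B p U dAB A0 uU vU]; [exact: (xe (true, i))|exact: (xe (false, i))|].
pose P (bi : bool * 'I_n) := if bi.1 then bi.2 \in A else bi.2 \in A :|: B.
have countP : count P s = (2 * #|A| + #|B|)%N.
  have cE (C : {set 'I_n}) : count [pred i | i \in C] (enum 'I_n) = #|C|.
    rewrite cardE -size_filter enumT; congr size; exact: seq.eq_filter.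
  transitivity (#|A :|: B| + #|A|)%N; first by rewrite -!cE count_cat !count_map.
  by move: dAB; rewrite -(leq_card_setU A B) => /eqP ->; lia.
pose iota : 'Hom('rV[F]_d, 'rV[F]_(1 + d)) := linfun (mulmxr (row_mx 0 1%:M)).
have iotaE w : iota w = row_mx 0 w.
  by rewrite lfunE /= mul_mx_row mulmx0 mulmx1.
pose W := (<[homogenize true p]> + iota @: U)%VS.
have dimW : (\dim W <= 1 + \dim U)%N.
  rewrite (leq_trans (dimv_add_leqif _ _)) // leq_add //.
    by rewrite dim_vline leq_b1.
  by rewrite -(limg_ker_dim iota U) leq_addl.
have sW : (<<[seq homogenize i.1 (x i) | i <- s & P i]>> <= W)%VS.
  apply/span_subvP => _ /mapP[[b i] + ->]; rewrite mem_filter => /andP[Pi _].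
  case: b Pi => /= Pi; last first.
    apply: (subvP (addvSr _ _)).
    have -> : homogenize false (x (false, i)) = iota (x (false, i)).
      by rewrite iotaE /homogenize raddf0.
    by apply: memv_img; apply: vU.
  have -> : homogenize true (x (true, i)) = homogenize true p + iota (x (true, i) - p).
    by rewrite iotaE /homogenize add_row_mx addr0 addrC subrK.
  by apply: memv_add; [exact: memv_line|apply: memv_img; apply: uU].
have := xP P; rewrite countP => /(_ _)/leq_trans/(_ (dimvS sW)).
have hP : has fst (seq.filter P s).
  have /finset.set0Pn[i iA] := A0; apply/hasP; exists (true, i) => //.
  by rewrite mem_filter /P /= iA mem_cat orbC map_f ?mem_enum.
move=> /(_ hP) /leq_trans/(_ dimW).
have : (0 < #|A|)%N by rewrite card_gt0.
by case: #|A| => // a _; rewrite mulnS /= minnSS.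
Qed.

(** * From generic parameters to lines in general position *)

Definition line (R : realType) (d : nat) (p v : 'rV[R]_d) : set 'rV[R]_d :=
  [set p + t *: v | t in [set: R]].

Lemma sub_line_flat (R : realType) (d : nat) (p v q : 'rV[R]_d) (U : {vspace 'rV[R]_d}) :
  line p v `<=` flat q U -> p - q \in U /\ v \in U.
Proof.
move=> lU.
have pU : p - q \in U by apply: lU; exists 0; rewrite // scale0r addr0.
split=> //; have : p + v - q \in U by apply: lU; exists 1; rewrite // scale1r.
by rewrite addrAC rpredDl.
Qed.

Lemma card_imfset_fintype (T : finType) (K : choiceType) (f : T -> K) (p : finmempred T)
    (key : unit) : injective f -> #|` imfset key f p| = #|p|.
Proof.
move=> f_inj; rewrite card_imfset // cardE; apply/perm_size/uniq_perm.
- exact: enum_finmem_uniq.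
- exact: enum_uniq.
- by move=> x; rewrite enum_finmemE mem_enum.
Qed.

Section GenericLines.
Variables (R : realType) (d n : nat) (u v : 'I_n -> 'rV[R]_d).
Hypothesis uv_generic : generic_lines u v.
Let l i := line (u i) (v i).

(** If [l i = l j] with [i != j], then [A = {i}], [B = {j}] and the span [U] of [v i] contradict
    genericity, which forces dimension [2]. *)
Lemma generic_lines_inj : (2 <= d)%N -> injective l.
Proof.
move=> d2 i j lij; apply: contraTeq d2 => ij; rewrite -ltnNge.
have li : l i `<=` flat (u i) <[v i]>.
  by move=> _ [t _ <-]; rewrite /flat /= addrAC subrr add0r memvZ ?memv_line.
have [_ vj] : u j - u i \in <[v i]>%VS /\ v j \in <[v i]>%VS.
  by apply: sub_line_flat; rewrite -[line _ _]lij.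
have := @uv_generic [set i]%SET [set j]%SET (u i) <[v i]>%VS.
rewrite !cards1 dim_vline disjoints1 inE ij => /(_ isT)/(_ _)/(_ _)/(_ _)H.
have : (minn d 2 <= (v i != 0)%R)%N.
  apply: H => [|k|k].
  - by apply/finset.set0Pn; exists i; rewrite inE.
  - by move=> /finset.set1P ->; rewrite subrr mem0v.
  - by rewrite !inE => /orP[] /eqP -> //; exact: memv_line.
by move=> /leq_trans/(_ (leq_b1 _)); rewrite geq_min; lia.
Qed.

Lemma generic_lines_neq0 i : (0 < d)%N -> v i != 0.
Proof.
move=> d0; apply: contraTneq d0 => vi; rewrite -leqNgt.
have := @uv_generic [set i]%SET finset.set0 (u i) 0%VS.
rewrite cards1 cards0 dimv0 disjoint_sym finset.disjoints_subset finset.sub0set => /(_ isT) uv0.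
have : (minn d 1 <= 0)%N.
  apply: uv0 => [|j|j]; first by apply/finset.set0Pn; exists i; rewrite inE.
    by move=> /finset.set1P ->; rewrite subrr mem0v.
  by rewrite finset.setU0 => /finset.set1P ->; rewrite vi mem0v.
by rewrite geq_min orbF.
Qed.

Lemma generic_lines_general_position :
  (2 <= d)%N -> general_position [fset l i | i in 'I_n]%fset.
Proof.
move=> d2 A B p U AL BL dAB A0 AU BU.
have linj := generic_lines_inj d2.
pose pre (C : {fset set 'rV[R]_d}) := [set i | l i \in C]%SET.
have cardpre C : (C `<=` [fset l i | i in 'I_n])%fset -> #|` C| = #|pre C|.
  move=> CL; have {1}-> : C = [fset l i | i in pre C]%fset.
    apply/fsetP => m; apply/idP/imfsetP => [mC|[i /=]]; last by rewrite inE => iC ->.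
    have /imfsetP[i _ mE] := fsubsetP CL _ mC.
    by exists i; rewrite //= inE -mE.
  exact: card_imfset_fintype.
rewrite (cardpre A) // (cardpre B) //; apply: (@uv_generic _ _ p) => [|||i].
- rewrite -finset.setI_eq0; apply/eqP/setP => i; rewrite !inE; apply/negP => /andP[iA iB].
  by have := fdisjointP dAB _ iA; rewrite iB.
- have /fset0Pn[m mA] := A0; have /imfsetP[i _ mE] := fsubsetP AL _ mA.
  by apply/finset.set0Pn; exists i; rewrite inE -mE.
- by move=> i; rewrite inE => /AU/sub_line_flat[].
- by rewrite !inE => /orP[/AU/sub_line_flat[]|/BU[q]/sub_line_flat[]].
Qed.
End GenericLines.

(** * Estimates for quadratic functions and chords of a parabola *)

(** This is one term of an interpolation formula with nodes at least [1/2] apart: its denominator is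
    at least [1/4], whence [16 = 4 * 4]. *)
Lemma norm_ratio_le (F : realFieldType) (a b c x y m B : F) :
  `|a| <= 4 * m -> `|b| <= B -> `|c| <= B -> 2^-1 <= `|x| -> 2^-1 <= `|y| ->
  `|a * (b * c / (x * y))| <= 16 * (B ^+ 2 * m).
Proof.
move=> am bB cB x2 y2.
have x0 : 0 < `|x| by lra.
have y0 : 0 < `|y| by lra.
rewrite !normrM normfV normrM.
have bc : `|b| * `|c| <= B ^+ 2 by rewrite expr2 ler_pM.
have xy : (`|x| * `|y|)^-1 <= 4.
  have -> : (4 : F) = (2^-1 * 2^-1)^-1 by field.
  by rewrite lef_pV2 ?posrE ?mulr_gt0 ?invr_gt0 ?ltr0n // ler_pM // invr_ge0 ler0n.
have -> : 16 * (B ^+ 2 * m) = 4 * m * (B ^+ 2 * 4) by ring.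
have xy0 : 0 <= (`|x| * `|y|)^-1 by rewrite invr_ge0 mulr_ge0.
by rewrite ler_pM ?ler_pM ?mulr_ge0.
Qed.

(* By Lagrange interpolation at [x], [y], [z]. *)
Lemma quadratic_bound (F : realFieldType) (q : F -> F) (b c e m B x y z : F) :
  (forall u, q u = c + e * u - b * u ^+ 2) ->
  2^-1 <= `|x - y| -> 2^-1 <= `|y - z| -> 2^-1 <= `|z - x| ->
  `|q x| <= 4 * m -> `|q y| <= 4 * m -> `|q z| <= 4 * m ->
  `|b| <= 48 * m /\
  forall u, `|u - x| <= B -> `|u - y| <= B -> `|u - z| <= B -> `|q u| <= 48 * (B ^+ 2 * m).
Proof.
move=> qE xy yz zx qx qy qz.
have n0 (u v : F) : 2^-1 <= `|u - v| -> u - v != 0.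
  by apply: contraTneq => ->; rewrite normr0 -ltNge invr_gt0 ltr0n.
have [[xy0 yz0] zx0] := (n0 _ _ xy, n0 _ _ yz, n0 _ _ zx).
have three (f g h M : F) : `|f| <= 16 * M -> `|g| <= 16 * M -> `|h| <= 16 * M ->
    `|f + g + h| <= 48 * M.
  by move=> fM gM hM; rewrite (le_trans (ler_normD _ _)) //;
     have := ler_normD f g; lra.
split=> [|u ux uy uz].
  have -> : b = q x * (1 * 1 / ((x - y) * (z - x))) + q y * (1 * 1 / ((x - y) * (y - z)))
              + q z * (1 * 1 / ((z - x) * (y - z))) by rewrite !qE; field; rewrite xy0 yz0 zx0.
  have -> : 48 * m = 48 * (1 ^+ 2 * m) by rewrite expr1n mul1r.
  by apply: three; apply: norm_ratio_le => //; rewrite normr1.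
have -> : q u = q x * ((u - y) * (z - u) / ((x - y) * (z - x)))
              + q y * ((x - u) * (u - z) / ((x - y) * (y - z)))
              + q z * ((u - x) * (y - u) / ((z - x) * (y - z))).
  by rewrite !qE; field; rewrite xy0 yz0 zx0.
by apply: three; apply: norm_ratio_le => //; rewrite distrC.
Qed.

(* The value [e * (x ^+ 2 - (x - a) ^+ 2 + w ^+ 2)] is that of the chord cutting off the arc
   of the parabola above the interval of radius [w] around [a]. *)
Lemma below_chord (F : realFieldType) (a s w C dl e x y z t : F) :
  0 < w <= 1 -> 0 < e <= 1 -> 0 <= C -> 0 <= dl -> (C + 1) * dl <= w ^+ 2 / 4 ->
  `|a - s| <= w / 2 -> 0 <= x <= 1 -> `|x - s| <= C * (dl * e) ->
  `|y - x * z| <= C * (dl * e) -> `|z - t - e * x| <= dl * e ->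
  y - t * x < e * (2 * a * x - a ^+ 2 + w ^+ 2).
Proof.
move=> /andP[w0 w1] /andP[e0 e1] C0 dl0 Cdl as_ /andP[x0 x1] xs yxz ztx.
have Cdl0 : 0 <= C * dl by rewrite mulr_ge0.
have w2w : w ^+ 2 <= w by rewrite expr2 ler_piMl // ltW.
have xa : `|x - a| <= 3 / 4 * w.
  have : C * (dl * e) <= C * dl by rewrite mulrA ler_piMr.
  have : `|x - a| <= `|x - s| + `|a - s| by rewrite (distrC a s) ler_distD.
  by nra.
have xa2 : (x - a) ^+ 2 <= 9 / 16 * w ^+ 2.
  move: xa; rewrite ler_norml => /andP[lxa uxa].
  have : 0 <= (3 / 4 * w - (x - a)) * (3 / 4 * w + (x - a)) by rewrite mulr_ge0 //; lra.
  by have -> : 9 / 16 * w ^+ 2 = (3 / 4 * w) ^+ 2 by [field]; rewrite -subr_sqr subr_ge0.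
have xz : x * (z - t - e * x) <= dl * e.
  by apply: le_trans (ler_norm _) _; rewrite normrM -[leRHS]mul1r ler_pM // ger0_norm.
have yq : y - x * z <= C * (dl * e) by apply: le_trans (ler_norm _) _.
have w20 : 0 < w ^+ 2 by rewrite exprn_gt0.
(* The first two terms add up to at most [e * w ^+ 2 / 4], while the chord is above the parabola at
   [x] by [e * (w ^+ 2 - (x - a) ^+ 2)], at least [7 / 16 * e * w ^+ 2]. *)
have -> : y - t * x = (y - x * z) + x * (z - t - e * x) + e * x ^+ 2 by ring.
have -> : e * (2 * a * x - a ^+ 2 + w ^+ 2) = e * (w ^+ 2 - (x - a) ^+ 2) + e * x ^+ 2 by ring.
rewrite ltrD2r.
apply: (@le_lt_trans _ _ (e * ((C + 1) * dl))); first by lra.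
by rewrite ltr_pM2l //; lra.
Qed.

(** * Slabs around pieces of parabolas, at several scales and heights *)

Definition cx (R : realType) (d : nat) (p : 'rV[R]_d.+3) : R := p 0 (@Ordinal d.+3 0 isT).
Definition cy (R : realType) (d : nat) (p : 'rV[R]_d.+3) : R := p 0 (@Ordinal d.+3 1 isT).
Definition cz (R : realType) (d : nat) (p : 'rV[R]_d.+3) : R := p 0 (@Ordinal d.+3 2 isT).

Section Construction.
Variables (R : realType) (d n k : nat).
Local Notation pt := 'rV[R]_d.+3.

Lemma cxD (p v : pt) (t : R) : cx (p + t *: v) = cx p + t * cx v.
Proof. by rewrite /cx !mxE. Qed.
Lemma cyD (p v : pt) (t : R) : cy (p + t *: v) = cy p + t * cy v.
Proof. by rewrite /cy !mxE. Qed.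
Lemma czD (p v : pt) (t : R) : cz (p + t *: v) = cz p + t * cz v.
Proof. by rewrite /cz !mxE. Qed.

(** A third of the spacing [1 / (n + 1)] of the abscissae of the lines. *)
Definition width : R := (3 * n.+1%:R)^-1.
(** Heights are at most [2 k]; the extra [2] leaves room for tilt and thickness. *)
Definition zmax : R := k.*2.+2%:R.
(** The factor [48 * B ^+ 2] of [quadratic_bound] with [B = zmax]. *)
Definition blowup : R := 48 * zmax ^+ 2.
(** The solution [dl] of [(C + 1) * dl = width ^+ 2 / 4] for [C = blowup], as [below_chord]
    demands. *)
Definition ratio : R := width ^+ 2 / (4 * (blowup + 1)).
Definition scale (r : nat) : R := ratio ^+ r.+1.
(** As [6 (n + 1)] steps of [width / 2] have total length [1], the indices up to [6 (n + 1)] cover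
    the unit interval. *)
Definition center (g : nat) : R := g%:R * (width / 2).

Lemma width_bounds : 0 < width <= 1.
Proof.
rewrite invr_gt0 mulr_gt0 //= invf_le1 ?mulr_gt0 //.
by rewrite -natrM ler1n.
Qed.

Lemma mul_width : n.+1%:R * width = 3^-1.
Proof. by rewrite /width invfM mulrCA mulfV ?mulr1 ?pnatr_eq0. Qed.

Lemma zmax_ge2 : 2 <= zmax.
Proof. by rewrite ler_nat. Qed.

Lemma blowup_ge1 : 1 <= blowup.
Proof. by rewrite /blowup; have := zmax_ge2; nra. Qed.

Lemma ratioE : (blowup + 1) * ratio = width ^+ 2 / 4.
Proof. by rewrite /ratio; field; have := blowup_ge1; lra. Qed.

Lemma ratio_bounds : 0 < ratio <= 8^-1.
Proof.
have /andP[w0 w1] := width_bounds; have b1 := blowup_ge1; have rE := ratioE.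
have : width ^+ 2 <= 1 by rewrite expr_le1 // ltW.
have : 0 < width ^+ 2 by rewrite exprn_gt0.
by move=> ? ?; apply/andP; split; nra.
Qed.

Lemma scaleS r : scale r.+1 = ratio * scale r.
Proof. exact: exprS. Qed.

Lemma scale_gt0 r : 0 < scale r.
Proof. by rewrite exprn_gt0 //; case/andP: ratio_bounds. Qed.

Lemma scale_le r s : (r <= s)%N -> scale s <= scale r.
Proof.
have /andP[r0 r1] := ratio_bounds; move=> rs.
by apply: ler_wiXn2l; rewrite ?ltW //; lra.
Qed.

Lemma scale_le8 r : scale r <= 8^-1.
Proof.
rewrite (le_trans (scale_le (leq0n r))) // /scale expr1.
by case/andP: ratio_bounds.
Qed.

(* Each [g] in [A] cuts off the arc of the parabola [y - t * x = scale r * x ^+ 2] above the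
   interval of radius [width] around [center g]. *)
Definition slab (r t : nat) (A : {set 'I_(6 * n.+1).+1}) : set pt :=
  [set p | [/\ `|cz p - t%:R - scale r * cx p| <= scale r.+1,
     0 <= cx p <= 1,
     - scale r <= cy p - t%:R * cx p <= 2 * scale r
   & forall g, g \in A -> scale r * (2 * center g * cx p - center g ^+ 2 + width ^+ 2)
       <= cy p - t%:R * cx p]].

(** Every condition is a linear inequality in the coordinates, since [r], [t] and the centers are
    fixed. *)
Lemma slab_convex r t A : convex_set (slab r t A).
Proof.
move=> p q lam; rewrite !inE => -[p1 /andP[p2 p3] /andP[p4 p5] p6] [q1 /andP[q2 q3] /andP[q4 q5] q6].
have convE (i : 'I_d.+3) : (conv lam p q : pt) 0 i = lam%:num * p 0 i + (1 - lam%:num) * q 0 i.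
  by rewrite !mxE.
have l0 : 0 <= lam%:num by [].
have l1 : 0 <= 1 - lam%:num by rewrite subr_ge0.
have avg (f g M h : R) : f <= M -> g <= M ->
    h = lam%:num * f + (1 - lam%:num) * g -> h <= M.
  move=> fM gM ->; have := mulr_ge0 l0 (_ : 0 <= M - f); have := mulr_ge0 l1 (_ : 0 <= M - g).
  by rewrite !subr_ge0 => /(_ gM) + /(_ fM); lra.
have avg' (f g M h : R) : M <= f -> M <= g ->
    h = lam%:num * f + (1 - lam%:num) * g -> M <= h.
  by move=> fM gM hE; rewrite -lerN2; apply: (avg (- f) (- g)); rewrite ?lerN2 // hE; ring.
rewrite /= /slab /= /cx /cy /cz !convE.
rewrite -/(cx p) -/(cy p) -/(cz p) -/(cx q) -/(cy q) -/(cz q).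
move: p1 q1; rewrite !ler_norml => /andP[p1 p1'] /andP[q1 q1']; split.
- apply/andP; split; first by apply: (avg' _ _ _ _ p1 q1); ring.
  by apply: (avg _ _ _ _ p1' q1'); ring.
- apply/andP; split; first by apply: (avg' _ _ _ _ p2 q2); ring.
  by apply: (avg _ _ _ _ p3 q3); ring.
- apply/andP; split; first by apply: (avg' _ _ _ _ p4 q4); ring.
  by apply: (avg _ _ _ _ p5 q5); ring.
- move=> g gA; have := p6 g gA; rewrite -subr_ge0 => p7.
  have := q6 g gA; rewrite -subr_ge0 => q7; rewrite -subr_ge0.
  by apply: (avg' _ _ _ _ p7 q7); ring.
Qed.

(** The line meets a neighbourhood of the ruling segment [y = t x], [z = t]. Unlike the slabs, which
    tilt with [r], these neighbourhoods shrink as [r] grows, and they do not depend on [A]. *)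
Definition meets_at (l : set pt) (r t : nat) : Prop :=
  exists2 p, l p & [/\ 0 <= cx p <= 1, `|cz p - t%:R| <= 2 * scale r
    & `|cy p - cx p * cz p| <= 4 * scale r].

(** Tilt and thickness each contribute at most [scale r] to [z - t]; then
    [y - x z = (y - t x) - x (z - t)]. *)
Lemma slab_near r t A p : slab r t A p ->
  [/\ 0 <= cx p <= 1, `|cz p - t%:R| <= 2 * scale r & `|cy p - cx p * cz p| <= 4 * scale r].
Proof.
move=> [p1 /andP[p2 p3] /andP[p4 p5] _].
have s0 := scale_gt0 r; have /andP[r0 r8] := ratio_bounds.
have sS : scale r.+1 <= scale r by apply: scale_le.
have zt : `|cz p - t%:R| <= 2 * scale r.
  have -> : cz p - t%:R = (cz p - t%:R - scale r * cx p) + scale r * cx p by ring.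
  rewrite (le_trans (ler_normD _ _)) //.
  have -> : `|scale r * cx p| = scale r * cx p by rewrite ger0_norm // mulr_ge0 // ltW.
  by nra.
split=> //; first by rewrite p2.
have -> : cy p - cx p * cz p = (cy p - t%:R * cx p) - cx p * (cz p - t%:R) by ring.
rewrite (le_trans (ler_normB _ _)) // normrM (ger0_norm p2).
have : `|cy p - t%:R * cx p| <= 2 * scale r by rewrite ler_norml p5 andbT; lra.
by have := normr_ge0 (cz p - t%:R); nra.
Qed.

(* At most two times means that [l] is transversal to the ruling at scale [r]; three times
   force it to run along the ruling. *)
Definition times (l : set pt) (r : nat) : {set 'I_k.*2.+1} :=
  [set t : 'I_k.*2.+1 | `[< meets_at l r t >]]%SET.

Lemma times_sub l r s : (r <= s)%N -> times l s \subset times l r.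
Proof.
move=> /scale_le rs; apply/fintype.subsetP => t; rewrite !inE => -[p lp [p1 p2 p3]].
by exists p => //; split=> //; lra.
Qed.

Lemma center_near (s : R) : 0 <= s <= 1 ->
  exists g : 'I_(6 * n.+1).+1, `|center g - s| <= width / 2.
Proof.
move=> /andP[s0 s1]; have /andP[w0 w1] := width_bounds.
have h0 : 0 < width / 2 by rewrite divr_gt0.
pose g := Num.truncn (s / (width / 2)).
have /andP[gs sg] : g%:R <= s / (width / 2) < g.+1%:R.
  by apply: Num.Theory.truncn_itv; rewrite divr_ge0 // ltW.
rewrite ler_pdivlMr // in gs; rewrite ltr_pdivrMr // in sg.
have gG : (g < (6 * n.+1).+1)%N.
  rewrite ltnS -(ler_nat R) natrM.
  have : g%:R * (width / 2) <= (6 * n.+1%:R) * (width / 2).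
    by rewrite (le_trans gs) // (le_trans s1) //; have := mul_width; lra.
  by rewrite ler_pM2r.
exists (Ordinal gG); rewrite /center /= ler_norml; move: sg.
by rewrite -natr1 => sg; apply/andP; split; lra.
Qed.

Lemma nat_dist (i j : 'I_k.*2.+1) : i != j -> 1 <= `|i%:R - j%:R : R|.
Proof.
rewrite -val_eqE /= neq_ltn ler_normr => /orP[] ij; apply/orP; [right|left].
  by rewrite opprB lerBrDl natr1 ler_nat.
by rewrite lerBrDl natr1 ler_nat.
Qed.

Lemma nat_dist_le (i j : 'I_k.*2.+1) : `|i%:R - j%:R : R| <= zmax - 2.
Proof.
have -> : zmax - 2 = k.*2%:R :> R by rewrite /zmax -[in LHS]addn2 natrD addrK.
have b (m : 'I_k.*2.+1) : 0 <= (m%:R : R) <= k.*2%:R by rewrite ler0n ler_nat -ltnS ltn_ord.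
by rewrite ler_norml; have /andP[? ?] := b i; have /andP[? ?] := b j; apply/andP; split; lra.
Qed.

(** Along [l], [y - x z] is quadratic in [z] and small at three separated heights, so it is small at
    all relevant heights, and so is its leading coefficient, minus the slope of [x]. Thus [l] stays
    near one line of the ruling, and one [g] works for all [t] and [A]. Closeness is assumed at
    scale [r.+1] so that errors magnified by [blowup] are still small at scale [r]. *)
Lemma near_ruling_line l r : is_line l -> (2 < #|times l r.+1|)%N ->
  exists g : 'I_(6 * n.+1).+1, forall (t : 'I_k.*2.+1) (A : {set 'I_(6 * n.+1).+1}),
    g \in A -> forall p, l p -> ~ slab r t A p.
Proof.
move=> [u [v [_ lE]]] /card_gt2P[t1 [t2 [t3 [[]]]]].
rewrite !inE => -[p1 lp1 [x1 z1 q1]] [p2 lp2 [x2 z2 q2]] [p3 lp3 [x3 z3 q3]].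
move=> [/nat_dist t12 /nat_dist t23 /nat_dist t31].
have s0 := scale_gt0 r.+1; have s8 := scale_le8 r.+1; have s8r := scale_le8 r.
have s0r := scale_gt0 r.
have sSr : scale r.+1 <= scale r by apply: scale_le.
(* Heights at least [1] apart lose at most [4 * scale r.+1 <= 1 / 2]. *)
have far (p q : pt) (t t' : R) : 1 <= `|t - t'| ->
    `|cz p - t| <= 2 * scale r.+1 -> `|cz q - t'| <= 2 * scale r.+1 -> 2^-1 <= `|cz p - cz q|.
  move=> tt pt' qt'.
  have : `|t - t'| <= `|cz p - t| + `|cz p - cz q| + `|cz q - t'|.
    have := ler_distD (cz p) t t'; have := ler_distD (cz q) (cz p) t'.
    by rewrite (distrC t (cz p)); lra.
  by lra.
have z12 := far _ _ _ _ t12 z1 z2.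
have z23 := far _ _ _ _ t23 z2 z3.
have z31 := far _ _ _ _ t31 z3 z1.
have vz : cz v != 0.
  apply: contraTneq z12 => vz; move: lp1 lp2; rewrite lE => -[a _ <-] [b _ <-].
  by rewrite !czD vz !mulr0 subrr normr0 -ltNge invr_gt0 ltr0n.
pose b := cx v / cz v; pose a := cx u - b * cz u.
pose b' := cy v / cz v; pose a' := cy u - b' * cz u.
have lx p : l p -> cx p = a + b * cz p.
  by rewrite lE => -[t _ <-]; rewrite cxD czD /a /b; field.
have ly p : l p -> cy p = a' + b' * cz p.
  by rewrite lE => -[t _ <-]; rewrite cyD czD /a' /b'; field.
pose q (z : R) := a' + b' * z - (a + b * z) * z.
have qE z : q z = a' + (b' - a) * z - b * z ^+ 2 by rewrite /q; ring.
have lq p : l p -> cy p - cx p * cz p = q (cz p) by move=> lp; rewrite /q -lx // -ly.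
rewrite !lq // in q1 q2 q3.
have [b48 qB] := @quadratic_bound R q b a' (b' - a) (scale r.+1) zmax _ _ _ qE z12 z23 z31 q1 q2 q3.
have [g gx1] := center_near x1; exists g => t A gA p lp pK.
have [[pz px py pA] zm2] := (pK, zmax_ge2).
have /andP[px0 px1] := px.
have zd (p' : pt) (t' : 'I_k.*2.+1) : `|cz p' - t'%:R| <= 2 * scale r.+1 -> `|cz p - cz p'| <= zmax.
  move=> zp'; have [_ zp _] := slab_near pK.
  have := nat_dist_le t t'; have := ler_distD t%:R (cz p) (cz p').
  have := ler_distD t'%:R (t%:R : R) (cz p').
  by move: zp'; rewrite (distrC t'%:R (cz p')); clear -zp s8 s8r; lra.
have /andP[r0 _] := ratio_bounds; have b1 := blowup_ge1.
have xg : `|cx p - cx p1| <= blowup * (ratio * scale r).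
  rewrite !lx // opprD addrACA subrr add0r -mulrBr normrM -scaleS.
  have := zd _ _ z1; have := normr_ge0 b; have := normr_ge0 (cz p - cz p1).
  rewrite /blowup; set m := scale _ in b48 *; set Z := zmax => ? ? ?.
  have bz : `|b| * `|cz p - cz p1| <= 48 * m * Z by apply: ler_pM.
  have mZ : m * Z <= m * Z ^+ 2 by rewrite ler_pM2l // expr2 ler_peMl // (le_trans _ zm2) ?ler1n.
  by clear -bz mZ; lra.
have := pA g gA; apply/negP; rewrite -ltNge.
(* With [dl = ratio] and [e = scale r], the product [dl * e] is the thickness [scale r.+1]. *)
apply: (@below_chord R _ (cx p1) _ blowup ratio _ _ _ (cz p)) => //.
- exact: width_bounds.
- by rewrite s0r (le_trans s8r) // invf_le1 // ler1n.
- by rewrite (le_trans _ b1).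
- exact: ltW.
- by rewrite ratioE.
- rewrite lq // -scaleS /blowup -mulrA; apply: qB; [exact: zd z1|exact: zd z2|exact: zd z3].
Qed.

(** Equal to [(i + 1) / (n + 1)]. *)
Definition abscissa (i : 'I_n) : R := i.+1%:R * (3 * width).

Lemma abscissa_bounds i : 3 * width <= abscissa i <= 1 - 3 * width.
Proof.
have /andP[w0 _] := width_bounds.
have n1 : 1 - 3 * width = n%:R * (3 * width).
  by have := mul_width; rewrite -natr1; lra.
have i1 : 1 <= (i.+1%:R : R) <= n%:R by rewrite ler1n ler_nat ltn_ord.
by rewrite n1 /abscissa -{1}[3 * width]mul1r !ler_pM2r ?mulr_gt0.
Qed.

Lemma abscissa_inj i j : `|abscissa i - abscissa j| < 3 * width -> i = j.
Proof.
have /andP[w0 _] := width_bounds; rewrite -mulrBl normrM [X in _ * X]ger0_norm ?mulr_ge0 ?ltW //.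
rewrite gtr_pMl ?mulr_gt0 // => ij; apply/val_inj/eqP; apply: contraTT ij => /= ij.
rewrite -leNgt ler_normr; case: (ltngtP i j) ij => // ij _; apply/orP; [right|left].
  by rewrite opprB lerBrDl natr1 ler_nat.
by rewrite lerBrDl natr1 ler_nat.
Qed.

(** The radius exceeds [width], which leaves the other lines a margin for perturbation, but it is
    only half the spacing of the abscissae. *)
Definition cut_off (A : {set 'I_(6 * n.+1).+1}) : {set 'I_n} :=
  [set i | [exists g in A, `|abscissa i - center g| < 3 / 2 * width]]%SET.

(** Two abscissae near the same center would be closer than their spacing, so each [g] accounts for
    at most one index. *)
Lemma card_cut_off A : (#|cut_off A| <= #|A|)%N.
Proof.
pose f i := odflt ord0 [pick g in A | `|abscissa i - center g| < 3 / 2 * width].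
have fP i : i \in cut_off A -> f i \in A /\ `|abscissa i - center (f i)| < 3 / 2 * width.
  rewrite inE /f => /existsP[g gP]; case: pickP => [g' /andP[]//|/(_ g)].
  by rewrite gP.
rewrite -(card_in_imset (f := f)) => [|i j /fP[_ fi] /fP[_ fj] fij].
  by apply/subset_leq_card/fintype.subsetP => _ /imsetP[i /fP[? _] ->].
apply: abscissa_inj; move: fj; rewrite -fij distrC.
by have := ler_distD (center (f i)) (abscissa i) (abscissa j); lra.
Qed.

(** The point [(s, s z, z)] with [z = t + scale r * s] lies on the parabola and satisfies every
    condition with some slack, against which [E] is small. *)
Lemma slab_perturbed r (t : 'I_k.*2.+1) (A : {set 'I_(6 * n.+1).+1}) (s E : R) (p : pt) :
  (r <= k)%N -> 3 * width <= s <= 1 - 3 * width ->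
  (forall g, g \in A -> 3 / 2 * width <= `|s - center g|) ->
  (zmax + 4) * E <= width ^+ 2 * scale k.+1 ->
  `|cx p - s| <= E -> `|cy p - s * (t%:R + scale r * s)| <= E ->
  `|cz p - (t%:R + scale r * s)| <= E -> slab r t A p.
Proof.
move=> rk /andP[s3 s1] sA Ek xE yE zE.
have [w0 w1] := andP width_bounds; have e8 := scale_le8 r; have e0 := scale_gt0 r.
have [E0 z2] : 0 <= E /\ 2 <= zmax by split; [exact: le_trans xE|exact: zmax_ge2].
have t0 : 0 <= (t%:R : R) <= zmax - 2.
  rewrite ler0n; have := nat_dist_le t ord0; rewrite subr0.
  by rewrite ger0_norm.
have w2 : 0 < width ^+ 2 <= width.
  by rewrite exprn_gt0 // expr2 ler_piMl // ltW.
(* [K] is at most the slack in each condition: [scale r.+1] for the thickness, [width] for [x], and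
   [width ^+ 2 * scale r] for the chords. *)
set K := width ^+ 2 * scale k.+1 in Ek.
have Kr : K <= scale r.+1.
  have sk : scale k.+1 <= scale r.+1 by apply: scale_le; rewrite ltnS.
  by apply: le_trans sk; rewrite ler_piMl ?(ltW (scale_gt0 _)) //; lra.
have Kw : K <= width ^+ 2 * scale r.
  by rewrite ler_pM2l; [apply: scale_le; rewrite (leq_trans rk) | case/andP: w2].
have er : scale r.+1 <= scale r by apply: scale_le.
have Kw' : K <= width by apply: le_trans Kw _; nra.
move: t0 => /andP[t0 t2].
pose a := cx p - s; pose b := cy p - s * (t%:R + scale r * s).
pose c := cz p - (t%:R + scale r * s).
have [xp [yp zp]] : cx p = s + a /\ cy p = s * (t%:R + scale r * s) + b /\
    cz p = t%:R + scale r * s + c by rewrite /a /b /c; split; [|split]; ring.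
rewrite -/a -/b -/c in xE yE zE; move: xE yE zE; rewrite !ler_norml.
move=> /andP[a1 a2] /andP[b1 b2] /andP[c1 c2].
have ta1 : - (t%:R * E) <= t%:R * a <= t%:R * E by rewrite -mulrN !ler_wpM2l.
have ea1 : - (scale r * E) <= scale r * a <= scale r * E by rewrite -mulrN !ler_wpM2l // ltW.
have tE : t%:R * E <= (zmax - 2) * E by rewrite ler_wpM2r.
have eE : scale r * E <= 8^-1 * E by rewrite ler_wpM2r.
have zE : 2 * E <= zmax * E by rewrite ler_wpM2r.
have es2 : 0 <= scale r * s ^+ 2 <= scale r.
  rewrite mulr_ge0 ?sqr_ge0 ?(ltW e0) //= ler_piMr ?(ltW e0) //.
  by rewrite expr_le1 //; lra.
move: ta1 ea1 es2 => /andP[ta1 ta2] /andP[ea1 ea2] /andP[es1 es2].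
split.
- rewrite zp xp ler_norml; have -> : t%:R + scale r * s + c - t%:R - scale r * (s + a)
    = c - scale r * a by ring.
  by apply/andP; split; lra.
- by rewrite xp; apply/andP; split; lra.
- have -> : cy p - t%:R * cx p = scale r * s ^+ 2 + b - t%:R * a by rewrite xp yp; ring.
  have : K <= scale r by lra.
  by move=> ?; apply/andP; split; lra.
- move=> g gA; rewrite -subr_ge0.
  (* The first term is the height of the unperturbed point above the chord; the others are
     errors. *)
  have -> : cy p - t%:R * cx p - scale r * (2 * center g * cx p - center g ^+ 2 + width ^+ 2)
    = scale r * ((s - center g) ^+ 2 - width ^+ 2) + b - t%:R * a - 2 * (center g * (scale r * a)).
    by rewrite xp yp; ring.
  have sg : 9 / 4 * width ^+ 2 <= (s - center g) ^+ 2.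
    have -> : 9 / 4 * width ^+ 2 = (3 / 2 * width) ^+ 2 by field.
    rewrite -[leRHS]real_normK ?num_real // ler_pXn2r ?nnegrE ?mulr_ge0 ?(ltW w0) //.
    exact: sA.
  have g01 : 0 <= center g <= 1.
    rewrite /center mulr_ge0 ?divr_ge0 ?(ltW w0) //=.
    have E1 : (6 * n.+1)%:R * (width / 2) = 1.
      by rewrite natrM; have := mul_width; lra.
    by rewrite -[leRHS]E1 ler_pM2r ?divr_gt0 // ler_nat -ltnS ltn_ord.
  have gea : center g * (scale r * a) <= 8^-1 * E.
    move: g01 => /andP[g0 g1].
    apply: (@le_trans _ _ (center g * (8^-1 * E))); first by rewrite ler_wpM2l //; lra.
    by rewrite ler_piMl // mulr_ge0.
  have : scale r * (5 / 4 * width ^+ 2) <= scale r * ((s - center g) ^+ 2 - width ^+ 2).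
    by rewrite ler_pM2l //; lra.
  by lra.
Qed.

End Construction.

(** * Pigeonhole choice of a scale and of a height *)

(** By monotonicity each [x] drops from true to false at one index at most, and there is one more
    index than elements of [M]. *)
Lemma exists_stable_index (T : choiceType) (M : {fset T}) (f : T -> nat -> bool) :
  (forall x r s, (r <= s)%N -> f x s -> f x r) ->
  exists2 r, (r <= #|` M|)%N & forall x, x \in M -> f x r -> f x r.+1.
Proof.
move=> f_anti; apply: contrapT => noteq.
have /choice[g gP] (r : 'I_(#|` M|).+1) : exists x, [/\ x \in M, f x r & ~~ f x r.+1].
  apply: contrapT => nx; apply: noteq; exists r; first by rewrite -ltnS.
  by move=> x xM fr; apply: contrapT => /negP nfr; apply: nx; exists x.
have g_inj : injective g.
  suff lt (r s : 'I_(#|` M|).+1) : (r < s)%N -> g r <> g s.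
    move=> r s grs; apply/val_inj/eqP; apply: contraT.
    by rewrite neq_ltn => /orP[]/lt; [move=> /(_ grs)|move=> /(_ (esym grs))].
  move=> rs grs; have [_ _ /negP] := gP r; apply.
  by rewrite grs; have [_ + _] := gP s; apply: f_anti.
have gM : ([fset g r | r in 'I_(#|` M|).+1] `<=` M)%fset.
  by apply/fsubsetP => _ /imfsetP[r _ ->]; have [] := gP r.
by have := fsubset_leq_card gM; rewrite card_imfset_fintype // card_ord ltnn.
Qed.

Lemma exists_notin_small_sets (T : choiceType) (M : {fset T}) (c N : nat) (H : T -> {set 'I_N}) :
  (forall x, x \in M -> #|H x| <= c)%N -> (#|` M| * c < N)%N ->
  exists t, forall x, x \in M -> t \notin H x.
Proof.
move=> Hc MN; pose U := (\bigcup_(x : M) H (val x))%SET.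
have cU : (#|U| <= #|` M| * c)%N.
  rewrite cardfE -sum_nat_const /U.
  elim/big_ind2: _ => [|A a B b Aa Bb|x _]; first by rewrite cards0.
    by rewrite (leq_trans (leq_card_setU A B)) // leq_add.
  by rewrite Hc // fsvalP.
have [t] : exists t, t \notin U.
  apply/existsP; apply: contraLR MN; rewrite negb_exists -leqNgt => /forallP tU.
  rewrite (leq_trans _ cU) // -[leqLHS]card_ord subset_leq_card //.
  by apply/fintype.subsetP => t _; have := tU t; rewrite negbK.
move=> tU; exists t => x xM; apply: contra tU => tx.
by apply/finset.bigcupP; exists [` xM]%fset.
Qed.

(** * The slabs and lines for given [eps] and [k] *)

Theorem theorem1 (R : realType) (d : nat) (eps : R) (k : int) :
  (3 <= d)%N -> 0 < eps < 1 ->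
  exists F L : {fset set 'rV[R]_d},
    [/\ forall K, K \in F -> convex_set K,
        L != fset0,
        forall l, l \in L -> is_line l
      & general_position L] /\
    (forall K, K \in F ->
       eps * #|` L|%:R <= #|` [fset l in L | `[< K `&` l !=set0 >]]%fset|%:R) /\
    (forall M : {fset set 'rV[R]_d},
       #|` M|%:Z = k -> (forall l, l \in M -> is_line l) ->
       exists K, K \in F /\ forall l, l \in M -> K `&` l = set0).
Proof.
(* For negative [k] no [M] has [k] elements, so the absolute value suffices. *)
case: d => [|[|[|d]]] // _ /andP[eps0 eps1]; set m := `|k|%N.
(* A slab will miss at most [m] lines, so [m <= (1 - eps) * n] is wanted. *)
pose n := (Num.truncn (m%:R / (1 - eps))).+1.
have kn : m%:R <= (1 - eps) * n%:R.
  rewrite mulrC -ler_pdivrMr ?subr_gt0 // ltW //.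
  have : 0 <= m%:R / (1 - eps) by rewrite divr_ge0 // subr_ge0 ltW.
  by move=> /Num.Theory.truncn_itv/andP[].
pose zm : R := zmax R m.
(* One factor [zm + 4] bounds the growth of the perturbation along a line up to parameter [zm]; the
   other is demanded by [slab_perturbed]. *)
pose e : R := width R n ^+ 2 * scale R n m m.+1 / (zm + 4) ^+ 2.
have zm2 : 2 <= zm := zmax_ge2 R m.
have w0 : 0 < width R n by case/andP: (width_bounds R n).
have e0 : 0 < e.
  apply: divr_gt0; last by apply: exprn_gt0; lra.
  by apply: mulr_gt0; [exact: exprn_gt0|exact: scale_gt0].
(* These parametrize the lines [l_s] by height; the default [0] of the lists fills the last [d]
   coordinates. *)
pose u0 (i : 'I_n) : 'rV[R]_d.+3 := \row_j [:: abscissa R i; 0; 0]`_j.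
pose v0 (i : 'I_n) : 'rV[R]_d.+3 := \row_j [:: 0; abscissa R i; 1]`_j.
have [u [v [ue ve uv]]] := exists_generic_lines u0 v0 e0.
pose T := ('I_m.+1 * 'I_m.*2.+1 * {set 'I_(6 * n.+1).+1})%type.
pose K (x : T) : set 'rV[R]_d.+3 := slab m x.1.1 x.1.2 x.2.
exists [fset K x | x in [pred x : T | (#|x.2| <= m)%N]]%fset.
exists [fset line (u i) (v i) | i in 'I_n]%fset.
have linj := generic_lines_inj uv isT.
have cardL : #|` [fset line (u i) (v i) | i in 'I_n]%fset| = n.
  by rewrite card_imfset_fintype // card_ord.
have meets (x : T) (i : 'I_n) : i \notin cut_off R x.2 -> K x `&` line (u i) (v i) !=set0.
  case: x => [[r t] A] /= iA; pose t0 : R := t%:R + scale R n m r * abscissa R i.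
  have /andP[s3 s1] := abscissa_bounds R i.
  have /andP[r0 r8] : 0 < scale R n m r <= 8^-1 by rewrite scale_gt0 scale_le8.
  have t00 : 0 <= t0 by rewrite addr_ge0 // mulr_ge0 ?(ltW r0) //; lra.
  have t0z : t0 <= zm.
    have : t%:R <= zm - 2 by have := nat_dist_le R t ord0; rewrite subr0 ger0_norm.
    have : scale R n m r * abscissa R i <= 8^-1 * 1 by apply: ler_pM; lra.
    by rewrite /t0; lra.
  have near j : `|(u i + t0 *: v i) 0 j - (u0 i 0 j + t0 * v0 i 0 j)| <= e * (zm + 4).
    have -> : (u i + t0 *: v i) 0 j - (u0 i 0 j + t0 * v0 i 0 j) =
        (u i 0 j - u0 i 0 j) + t0 * (v i 0 j - v0 i 0 j) by rewrite 2!mxE; ring.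
    rewrite (le_trans (ler_normD _ _)) // normrM (ger0_norm t00).
    have : t0 * `|v i 0 j - v0 i 0 j| <= zm * e by apply: ler_pM => //; exact: ltW.
    by have := ue i j; lra.
  exists (u i + t0 *: v i); split; last by exists t0.
  have coords : [/\ cx (u0 i) = abscissa R i, cy (u0 i) = 0, cz (u0 i) = 0 &
      [/\ cx (v0 i) = 0, cy (v0 i) = abscissa R i & cz (v0 i) = 1]].
    by rewrite /cx /cy /cz !mxE.
  have [ux uy uz [vx vy vz]] := coords.
  have nx := near (@Ordinal d.+3 0 isT).
  have ny := near (@Ordinal d.+3 1 isT).
  have nz := near (@Ordinal d.+3 2 isT).
  rewrite -/(cx _) -/(cx (u0 i)) -/(cx (v0 i)) ux vx mulr0 addr0 in nx.
  rewrite -/(cy _) -/(cy (u0 i)) -/(cy (v0 i)) uy vy add0r mulrC in ny.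
  rewrite -/(cz _) -/(cz (u0 i)) -/(cz (v0 i)) uz vz add0r mulr1 in nz.
  apply: (slab_perturbed _ _ _ _ nx ny nz).
  - by rewrite -ltnS.
  - by rewrite s3.
  - move=> g gA; rewrite leNgt; apply: contra iA => lt_g.
    by rewrite inE; apply/existsP; exists g; rewrite gA.
  - by rewrite /e mulrCA -expr2 divfK // expf_neq0 //; lra.
split; last split.
- split.
  + by move=> _ /imfsetP[x _ ->]; exact: slab_convex.
  + by rewrite -cardfs_gt0 cardL.
  + by move=> _ /imfsetP[i _ ->]; exists (u i), (v i); split=> //; apply: (generic_lines_neq0 uv).
  + exact: generic_lines_general_position.
- move=> _ /imfsetP[x /= xm ->]; rewrite cardL.
  apply: (@le_trans _ _ #|` [fset line (u i) (v i) | i in ~: cut_off R x.2]%fset|%:R).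
    rewrite card_imfset_fintype //.
    have := cardsC (cut_off R x.2); rewrite card_ord => cE.
    have : (#|cut_off R x.2| <= m)%N by apply: leq_trans (card_cut_off _ _) xm.
    rewrite -(ler_nat R); move/(congr1 (fun a => a%:R : R)): cE; rewrite natrD.
    by lra.
  rewrite ler_nat; apply: fsubset_leq_card; apply/fsubsetP => _ /imfsetP[i /= ic ->].
  rewrite !inE /=; apply/andP; split; first exact: in_imfset.
  by apply/asboolP/meets; rewrite inE in ic.
- move=> M Mk lM; have {Mk} Mm : #|` M| = m by rewrite /m -Mk.
  (* At this scale, a line near more than two heights is so at scale [r.+1] too, as
     [near_ruling_line] requires. *)
  have [r rm stable] := @exists_stable_index _ M (fun l r => (2 < #|times n m l r|)%N)
    (fun l r s rs => fun h => leq_trans h (subset_leq_card (times_sub n m l rs))).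
  rewrite Mm in rm.
  have /choice[g gP] (l : set 'rV[R]_d.+3) : exists g : 'I_(6 * n.+1).+1,
      l \in M -> (2 < #|times n m l r.+1|)%N -> 
      forall (t : 'I_m.*2.+1) (A : {set 'I_(6 * n.+1).+1}), g \in A -> 
      forall p, l p -> ~ slab m r t A p.
    have [/andP[lM' l3]|nl] := boolP ((l \in M) && (2 < #|times n m l r.+1|)%N).
      by have [g gP] := near_ruling_line (lM l lM') l3; exists g.
    by exists ord0 => lM' l3; rewrite lM' l3 in nl.
  (* All arcs around lines of [M] that run along the ruling are cut off at once. *)
  pose A : {set 'I_(6 * n.+1).+1} := [set x in map g (enum_fset M)]%SET.
  have Am : (#|A| <= m)%N by rewrite cardsE (leq_trans (card_size _)) // size_map Mm.
  (* The other lines exclude at most [2 m] of the [2 m + 1] heights; those handled by [A] exclude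
     none. *)
  have [||t tP] := @exists_notin_small_sets _ M 2 m.*2.+1
    (fun l => if (#|times n m l r| <= 2)%N then times n m l r else finset.set0).
  + by move=> l _; case: ifP => //; rewrite cards0.
  + by rewrite Mm muln2.
  exists (K (Ordinal (rm : (r < m.+1)%N), t, A)); split; first exact: in_imfset.
  move=> l lM'; apply/seteqP; split=> // p [pK pl].
  have [l3|l2] := ltnP 2 #|times n m l r|.
    apply: (gP l lM' (stable l lM' l3) t A _ p pl pK).
    by rewrite inE map_f.
  have := tP l lM'; rewrite l2 inE => /asboolPn; apply; exists p => //.
  exact: slab_near pK.
Qed.
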